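(* Let $n \geq 1$ and $k \geq 0$ be integers. If $\mathcal{F}$ is a locally $k$-wide family of arcs of $\mathbf{Z}_n$, then $|\mathcal{F}| \leq 2kn - k + 1$.
   Context: $\mathbf{Z}_n = \{0,1,\dots,n-1\}$ denotes the integers modulo $n$ with the clockwise cyclic order, in which $i$ precedes $i+1 \bmod n$. An arc of $\mathbf{Z}_n$ is a set of cyclically consecutive elements, i.e. a set of the form $\{i, i+1, \dots, i+m-1\}$ (modulo $n$) with $0 \leq m \leq n$; in particular the empty set and the whole set $\mathbf{Z}_n$ count as arcs. A family $\mathcal{F}$ of subsets of a finite set $X$ is locally $k$-wide iff for every $x \in X$ every antichain (with respect to inclusion) of $\{U \in \mathcal{F} \mid x \in U\}$ has at most $k$ members. *)

(* Defs.v *)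
From mathcomp Require Export all_boot.

Set Implicit Arguments.
Unset Strict Implicit.
Unset Printing Implicit Defensive.

Definition antichain (T : finType) (A : {set {set T}}) : Prop :=
  forall U V : {set T}, U \in A -> V \in A -> U \subset V -> U = V.

Definition locally_wide (T : finType) (k : nat) (F : {set {set T}}) : Prop :=
  forall (x : T) (A : {set {set T}}),
    A \subset [set U in F | x \in U] -> antichain A -> #|A| <= k.

(* Z_n is represented by 'I_n, with addition modulo n computed in nat: the
   type 'Z_n is not used because 'Z_1 has two elements.
   arc i m = {i, i + 1, ..., i + m - 1} modulo n. *)
Definition arc (n : nat) (i : 'I_n) (m : nat) : {set 'I_n} :=
  [set x : 'I_n | [exists j : 'I_m, val x == (i + j) %% n]].

Definition is_arc (n : nat) (U : {set 'I_n}) : Prop :=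
  exists (i : 'I_n) (m : nat), m <= n /\ U = arc i m.

(* Main.v *)
From Stdlib Require Import Classical.
Require Import Defs.
From mathcomp Require Import all_boot.
From mathcomp Require Import zify.

(* An arc {s, ..., t-1} is a chord (s, t), and overlapping arcs are crossing chords.
   On a line with vertices 0, ..., N, a set of chords without k+1 pairwise crossing
   ones has at most 2kN elements (a weak form of a theorem of Capoyleas and Pach):
   by induction on N, take a shortest chord of length > k and remove a vertex below
   it, which can be done losing at most 2k chords.

   For the cycle, unroll the nonempty proper arcs into an n-periodic family of
   chords of length < n.  Chords of length n can be added to it, together with
   their translates, over every vertex without a k-crossing above it; an exchange
   argument shows that one can add k orbits of them, and then one more orbit of
   chords of length 2n and period 2n.  The bound 2kN on a long window gives
   2 (|F| + k) + 1 <= 4kn for the nonempty proper arcs, and the empty and the full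
   arc add at most 2. *)

(** * Pairwise relations on sequences *)

Section Pairwise.
Variable T : eqType.

Lemma pairwise_sub_in (R R1 : rel T) (s : seq T) :
  pairwise R1 s -> uniq s ->
  (forall x y, x \in s -> y \in s -> x != y -> R1 x y -> R x y) ->
  pairwise R s.
Proof.
elim: s => [//|x s IH] /=.
move=> /andP[/allP ax ps] /andP[xs us] H; apply/andP; split.
  apply/allP => y ys; apply: H; rewrite ?mem_head ?inE ?ys ?orbT //; last exact: ax.
  by apply: contraNneq xs => ->.
by apply: IH => // y z ys zs; apply: H; rewrite inE ?ys ?zs orbT.
Qed.

Lemma pairwise_sym_in (R : rel T) (s : seq T) x y :
  symmetric R -> pairwise R s -> x \in s -> y \in s -> x != y -> R x y.
Proof.
move=> symR; elim: s => [//|z s IH] /= /andP[/allP az ps].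
rewrite !inE => /orP[/eqP->|xs] /orP[/eqP->|ys].
- by rewrite eqxx.
- by move=> _; apply: az.
- by move=> _; rewrite symR; apply: az.
- exact: IH.
Qed.

Lemma pairwise_irr_uniq (R : rel T) (s : seq T) :
  irreflexive R -> pairwise R s -> uniq s.
Proof.
move=> irrR; elim: s => [//|z s IH] /= /andP[/allP az /IH ->].
by rewrite andbT; apply/negP => /az; rewrite irrR.
Qed.

Lemma subset_map_lift (T' : eqType) (f : T -> T') (s : seq T) (c : seq T') :
  {subset c <= map f s} -> exists2 c0, c = map f c0 & {subset c0 <= s}.
Proof.
elim: c => [|y c IH] sub; first by exists [::].
have /mapP[x xs ->] := sub y (mem_head y c).
have [|c0 -> sub0] := IH; first by move=> z zc; apply: sub; rewrite inE zc orbT.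
by exists (x :: c0) => // z; rewrite inE => /orP[/eqP->|/sub0].
Qed.

End Pairwise.

Lemma size_injS (T T' : eqType) (g : T -> T') (s : seq T) (s' : seq T') :
  uniq s -> {in s &, injective g} -> (forall x, x \in s -> g x \in s') ->
  size s <= size s'.
Proof.
move=> us inj sub; rewrite -(size_map g s); apply: uniq_leq_size.
  by rewrite map_inj_in_uniq.
by move=> y /mapP[x xs ->]; apply: sub.
Qed.

Lemma snd_le_bigmax (s : seq (nat * nat)) y : y \in s -> y.2 <= \max_(q <- s) q.2.
Proof. by move=> ys; rewrite (big_rem y) //= leq_maxl. Qed.

(** * Chains in a 0/1 matrix and the deletion of one column *)

Section Matrix.
Variable M : nat -> nat -> bool.

Definition lt2 (x y : nat * nat) := (x.1 < y.1) && (x.2 < y.2).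

(* Read the rows upwards looking for a break, i.e. an entry in column 1, from the
   next row on in column 2, and so on; [nbreak r] counts the breaks in the rows
   below [r].  The breaks form a chain, so there are few of them. *)
Fixpoint nbreak r := if r is r'.+1 then nbreak r' + M (nbreak r').+1 r' else 0.

Lemma nbreak_le r r' : r <= r' -> nbreak r <= nbreak r'.
Proof.
elim: r' => [|r' IH]; first by rewrite leqn0 => /eqP->.
rewrite leq_eqVlt => /orP[/eqP-> //|]; rewrite ltnS => /IH /=; lia.
Qed.

(** The rows below [R] contain one break in each column from 1 to [nbreak R], in increasing rows;
    those in columns [x] to [y - 1] are kept. *)
Lemma nbreak_chain x y R : 0 < x -> y <= (nbreak R).+1 ->
  exists d : seq (nat * nat), [/\ pairwise lt2 d, size d = y - x &
    forall q : nat * nat, q \in d ->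
      [/\ M q.1 q.2, nbreak q.2.+1 = q.1, x <= q.1 < y & q.2 < R]].
Proof.
move=> x0; elim: R y => [|R IH] y ybr.
  by exists [::]; split=> //=; move: ybr => /=; lia.
case: (leqP y (nbreak R).+1) => yR.
  have [d [pd sd dP]] := IH _ yR; exists d; split=> // q /dP[? ? ? ?].
  by split=> //; lia.
have MR : M (nbreak R).+1 R by move: ybr yR => /=; case: M => //=; lia.
have ey : y = (nbreak R).+2 by move: ybr yR => /=; rewrite MR; lia.
case: (leqP x (nbreak R).+1) => xR; last by exists [::]; split=> //=; lia.
have [d [pd sd dP]] := IH (nbreak R).+1 (leqnn _).
exists (rcons d ((nbreak R).+1, R)); split.
- rewrite pairwise_rcons pd andbT; apply/allP => q /dP[_ _ ? ?].
  by rewrite /lt2 /=; lia.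
- by rewrite size_rcons sd; lia.
move=> q; rewrite mem_rcons inE => /orP[/eqP->|/dP[? ? ? ?]]; last by split=> //; lia.
split => //=; rewrite ?MR; lia.
Qed.

(* One column is deleted: in row [r] the columns [nbreak r.+1] and [(nbreak r.+1).+1] are
   identified.  Entries are lost only at breaks, since column [(nbreak r.+1).+1] is
   empty in every other row. *)
Definition delM x r := if x <= nbreak r.+1 then M x r else M x.+1 r.

(** Columns increase strictly along a chain. In [lift_chain] this shows that there are enough
    columns for the breaks to outnumber the entries they replace. *)
Lemma lt2_size (h : nat * nat) c1 (z : nat * nat) c2 : pairwise lt2 (h :: c1 ++ z :: c2) -> h.1 + size c1 < z.1.
Proof.
elim: c1 h => [|x c1 IH] h /=; first by move=> /andP[/andP[]]; rewrite /lt2; lia.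
by move=> /andP[/andP[hx _] /IH]; move: hx; rewrite /lt2; lia.
Qed.

(* An entry of [delM] comes from [M] with its column unchanged if that is at most
   [nbreak r.+1], and raised by one otherwise.  A raised entry followed by an
   unchanged one might collide, but there the raised entries are replaced by the
   breaks lying between the two rows. *)
Lemma lift_chain (c : seq (nat * nat)) : pairwise lt2 c ->
  (forall q : nat * nat, q \in c -> 0 < q.1 /\ delM q.1 q.2) ->
  exists d : seq (nat * nat), [/\ pairwise lt2 d, size c <= size d,
    forall q : nat * nat, q \in d -> M q.1 q.2 &
    forall x lo hi, (forall q : nat * nat, q \in c -> x <= q.1 /\ lo <= q.2 <= hi) ->
      forall q : nat * nat, q \in d -> x <= q.1 /\ lo <= q.2 <= hi].
Proof.
have [n] := ubnP (size c); elim: n c => // n IH [|h c] /=.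
  by move=> _ _ _; exists [::]; split.
rewrite ltnS => sc /andP[/allP hc pc] cP.
have [h0 Mh] := cP h (mem_head _ _).
have cP' (q : nat * nat) : q \in c -> 0 < q.1 /\ delM q.1 q.2.
  by move=> qc; apply: cP; rewrite inE qc orbT.
case: (leqP h.1 (nbreak h.2.+1)) => hbr.
  have [d [pd sd dM dB]] := IH c sc pc cP'.
  have hd (q : nat * nat) : q \in d -> lt2 h q.
    (* Only the lower bounds in [dB] matter: for nonempty [c] the largest row serves as [hi], and
       for empty [c] any value does, the premise being vacuous. *)
    case: (c) hc dB {IH pd dM} sd => [|z c'] hc dB sd qd.
      have := dB h.1.+1 h.2.+1 0 _ q qd; rewrite /lt2 => H.
      by have [] := H; last lia; move=> q'; rewrite in_nil.
    have [] := dB h.1.+1 h.2.+1 (\max_(y <- z :: c') y.2) _ q qd.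
      move=> y yc; have := hc y yc; rewrite /lt2 => /andP[? ?].
      by split=> //; apply/andP; split=> //; apply: snd_le_bigmax.
    by rewrite /lt2; lia.
  exists (h :: d); split=> //=.
  - by rewrite pd andbT; apply/allP.
  - move=> q; rewrite inE => /orP[/eqP->|/dM //].
    by move: Mh; rewrite /delM hbr.
  move=> x lo hi H q; rewrite inE => /orP[/eqP->|]; first exact/H/mem_head.
  by apply: dB => y yc; apply: H; rewrite inE yc orbT.
case: (boolP (has (fun q => q.1 <= nbreak q.2.+1) c)) => [hs|/hasPn nhs].
  have [c1 [z [c2 [zt ec]]]] : exists c1 z c2, z.1 <= nbreak z.2.+1 /\ c = c1 ++ z :: c2.
    elim: (c) hs => [//|y c' IHc] /=; case: (leqP y.1 (nbreak y.2.+1)) => yb.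
      by move=> _; exists [::], y, c'.
    by move=> /IHc[c1 [z [c2 [? ->]]]]; exists (y :: c1), z, c2.
  have := lt2_size h c1 z c2; rewrite -ec /= pc andbT => /(_ (introT allP hc)) sz.
  have zc q : q \in z :: c2 -> q \in c by rewrite ec mem_cat orbC => ->.
  have pz : pairwise lt2 (z :: c2) by move: pc; rewrite ec pairwise_cat => /and3P[].
  have [||d [pd sd dM dB]] := IH (z :: c2) _ pz.
  - by move: sc; rewrite ec size_cat /=; lia.
  - by move=> q /zc /cP'.
  (* As [z] is unchanged, the breaks below its row fill all columns from [h.1] to [z.1 - 1]. *)
  have zbr : z.1 <= (nbreak z.2).+1 by move: zt => /=; case: M; lia.
  have [e [pe se eP]] := nbreak_chain h.1 z.1 z.2 h0 zbr.
  (* Since [h] is raised, [h.1] exceeds [nbreak h.2.+1], so columns from [h.1] on have no break up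
     to row [h.2]. *)
  have hrow (q : nat * nat) : q \in e -> h.2 < q.2.
    move=> /eP[_ qe /andP[hq _] _]; rewrite ltnNge; apply/negP => qh.
    have : nbreak q.2.+1 <= nbreak h.2.+1 by apply: nbreak_le.
    by rewrite qe; lia.
  have zd (q : nat * nat) : q \in d -> z.1 <= q.1 /\ z.2 <= q.2.
    move=> qd; have [] := dB z.1 z.2 (\max_(y <- z :: c2) y.2) _ q qd.
      move=> y yz; have yb : y.2 <= \max_(y <- z :: c2) y.2.
        by apply: snd_le_bigmax.
      move: yz; rewrite inE => /orP[/eqP ey|yc2]; first by subst y; rewrite yb !leqnn.
      have /andP[/allP/(_ y yc2) /andP[zy1 zy2] _] := pz.
      by rewrite (ltnW zy1) (ltnW zy2) yb.
    by move=> ? /andP[].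
  exists (e ++ d); split.
  - rewrite pairwise_cat pe pd !andbT; apply/allrelP => q q' /eP[_ _ ? ?] /zd[? ?].
    by rewrite /lt2; lia.
  - by rewrite size_cat se; move: sd sz; rewrite ec size_cat /=; lia.
  - by move=> q; rewrite mem_cat => /orP[/eP[]|/dM].
  move=> x lo hi H q; rewrite mem_cat => /orP[qe|].
    have [? ?] := H h (mem_head _ _); have [? ? ? ?] := eP q qe.
    have := hrow q qe; have [] := H z; first by rewrite inE zc ?mem_head ?orbT.
    lia.
  by apply: dB => y /zc yc; apply: H; rewrite inE yc orbT.
have t1 (q : nat * nat) : q \in h :: c -> M q.1.+1 q.2.
  move=> qc; have [_] := cP q qc; rewrite /delM.
  move: qc; rewrite inE => /orP[/eqP->|/nhs]; first by rewrite leqNgt hbr.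
  by move=> /negbTE->.
exists [seq (q.1.+1, q.2) | q <- h :: c]; split.
- rewrite pairwise_map; move: (hc) => /allP hc'.
  by rewrite /= pc andbT.
- by rewrite size_map.
- by move=> q /mapP[y /t1 ? ->].
move=> x lo hi H q /mapP[y /H[? ?] ->] /=; lia.
Qed.

End Matrix.

(** * Chords of a line *)

Definition cross (x y : nat * nat) :=
  [&& x.1 < y.1, y.1 < x.2 & x.2 < y.2] || [&& y.1 < x.1, x.1 < y.2 & y.2 < x.2].

Definition crossfree (k : nat) (E : seq (nat * nat)) :=
  forall c, pairwise cross c -> {subset c <= E} -> size c <= k.

Lemma cross_sym : symmetric cross.
Proof. by move=> x y; rewrite /cross orbC. Qed.

Lemma cross_irr : irreflexive cross.
Proof. by move=> x; rewrite /cross ltnn. Qed.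

(** Every other chord of [c] has exactly one end strictly inside [x], and crossing chords share no
    ends; so [g], which picks that end, is injective into [x.2 - x.1 - 1] vertices. *)
Lemma cross_size (c : seq (nat * nat)) (x : nat * nat) :
  pairwise cross c -> x \in c -> x.1 < x.2 -> size c <= x.2 - x.1.
Proof.
case: x => s t pc xc /= lx.
have uc := pairwise_irr_uniq _ _ _ cross_irr pc.
have cP (y z : nat * nat) : y \in c -> z \in c -> y != z -> cross y z.
  exact: pairwise_sym_in cross_sym pc.
pose g (y : nat * nat) := if (s < y.1) && (y.1 < t) then y.1 else y.2.
have inj (y z : nat * nat) : y \in c -> z \in c -> y != (s, t) -> z != (s, t) ->
    g y = g z -> y = z.
  move=> yc zc yx zx gyz; apply/eqP; apply: contraT => yz.
  have := cP _ _ yc zc yz; have := cP _ _ yc xc yx; have := cP _ _ zc xc zx.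
  move: gyz; case: y z {yx zx yz yc zc} => y1 y2 [z1 z2]; rewrite /g /cross /=.
  do 2 case: ifP; lia.
have rng (y : nat * nat) : y \in c -> y != (s, t) -> s < g y < t.
  move=> yc yx; have := cP _ _ yc xc yx; case: y {yx yc} => y1 y2.
  rewrite /g /cross /=; case: ifP; lia.
have : size (rem (s, t) c) <= size (iota s.+1 (t - s.+1)).
  apply: (size_injS _ _ g); first exact: rem_uniq.
    move=> y z; rewrite !(rem_filter _ uc) !mem_filter => /andP[/= yx yc] /andP[/= zx zc].
    exact: inj.
  move=> y; rewrite (rem_filter _ uc) mem_filter => /andP[/= yx yc].
  by have := rng y yc yx; rewrite mem_iota; lia.
rewrite size_iota size_rem // -ltnS => h; apply: leq_trans (leqSpred _) (leq_trans h _); lia.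
Qed.

(* The chords crossing a fixed chord [(a, b)] are arranged in a 0/1 matrix: the
   column is the end strictly between [a] and [b], the row is the other end, and
   the rows are ordered as the vertices are met when going right from [b] and
   then, after [K], from the far left up to [a].  Two such chords cross iff
   their cells are strictly comparable. *)
Section Step.
Variables (k K a b : nat) (E : seq (nat * nat)).
Hypotheses (k0 : 0 < k) (uE : uniq E) (cE : crossfree k E).
Hypothesis bE : forall x : nat * nat, x \in E -> x.1 < x.2 < K.
Hypotheses (abE : (a, b) \in E) (ab : a + k < b).
Hypothesis abmin : forall x : nat * nat,
  x \in E -> a <= x.1 -> x.2 <= b -> x.1 + k < x.2 -> x = (a, b).

Definition isR e (x : nat * nat) := [&& a < x.1, x.1 < e & e < x.2].
Definition isL e (x : nat * nat) := [&& x.1 < a, a < x.2 & x.2 < e].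
Definition isI e (x : nat * nat) := (a <= x.1) && (x.2 <= e).

Notation toR := (isR b).
Notation toL := (isL b).
Notation inside := (isI b).

Definition col (x : nat * nat) := if toR x then x.1 - a else x.2 - a.
Definition row (x : nat * nat) := if toR x then x.2 else K + x.1.
Definition chord (q : nat * nat) :=
  if q.2 < K then (a + q.1, q.2) else (q.2 - K, a + q.1).

(** The tests on [col] and [row] discard the pairs that decode to a chord whose cell is
    elsewhere. *)
Definition M u r := let x := chord (u, r) in
  [&& x \in E, toR x || toL x, col x == u & row x == r].

Lemma chordK (x : nat * nat) : x \in E -> toR x || toL x -> chord (col x, row x) = x.
Proof.
case: x => s t /bE /= bst; rewrite /isL /chord /col /row /isR /=.
by case: (boolP [&& a < s, s < b & b < t]) => h /= h2; case: ifP => h3; congr pair; lia.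
Qed.

Lemma M_cell (x : nat * nat) : x \in E -> toR x || toL x -> M (col x) (row x).
Proof. by move=> xE xc; rewrite /M chordK // xE xc !eqxx. Qed.

Lemma M_chord (q : nat * nat) : M q.1 q.2 ->
  [/\ chord q \in E, toR (chord q) || toL (chord q), col (chord q) = q.1 & row (chord q) = q.2].
Proof. by case: q => u r /= /and4P[? ? /eqP ? /eqP ?]. Qed.

Lemma cross_lt2 (x y : nat * nat) : x \in E -> y \in E -> toR x || toL x -> toR y || toL y ->
  lt2 (col x, row x) (col y, row y) -> cross x y.
Proof.
move=> /bE bx /bE by_ xc yc; move: xc yc bx by_; rewrite /lt2 /isR /isL /col /row /cross /isR /=.
do 2 case: ifP => /=; lia.
Qed.

(** The chord [(a, b)] crosses every chord of a chain, which leaves room for fewer than [k]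
    cells. *)
Lemma M_size (d : seq (nat * nat)) : pairwise lt2 d ->
  (forall q : nat * nat, q \in d -> M q.1 q.2) -> size d < k.
Proof.
move=> pd dM.
have : size ((a, b) :: map chord d) <= k.
  apply: cE => /=.
    apply/andP; split.
      apply/allP => _ /mapP[q /dM/M_chord[_ qc _ _] ->].
      by move: qc; rewrite /isR /isL /cross /=; lia.
    rewrite pairwise_map; apply: (pairwise_sub_in _ _ lt2) => //.
      by apply: (pairwise_irr_uniq _ lt2) => // q; rewrite /lt2 ltnn.
    move=> x y xd yd _ xy.
    have [xE xc cx rx] := M_chord _ (dM _ xd).
    have [yE yc cy ry] := M_chord _ (dM _ yd).
    by apply: cross_lt2 => //; rewrite cx rx cy ry; exact: xy.
  move=> x; rewrite inE => /orP[/eqP->//|/mapP[q /dM/M_chord[? _ _ _] ->]] //.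
by rewrite /= size_map.
Qed.

Notation idx r := (nbreak M r.+1).

Lemma nbreak_lt r : nbreak M r < k.
Proof.
have [d [pd sd dM]] := nbreak_chain M 1 (nbreak M r).+1 r isT (leqnn _).
by have := M_size d pd; rewrite sd subn1; apply => q /dM[].
Qed.

(* The relabelling that removes one vertex: the exterior vertices move uniformly,
   the ends inside [(a, b)] according to the column deletion [delM]. *)
Definition shiftc u r := if u <= idx r then u else u.-1.
Definition shiftv v := if b <= v then v.-1 else v.

Definition contract (x : nat * nat) :=
  if toR x then (a + shiftc (col x) (row x), x.2.-1)
  else if toL x then (x.1, a + shiftc (col x) (row x))
  else if inside x then x else (shiftv x.1, shiftv x.2).

Definition lost (x : nat * nat) :=
  if toR x || toL x then col x == (idx (row x)).+1 else inside x && (x.2 == b).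

Lemma lost_row (x : nat * nat) : x \in E -> toR x || toL x -> lost x -> idx (row x) = (nbreak M (row x)).+1.
Proof.
move=> xE xc; rewrite /lost xc => /eqP cx.
have := M_cell _ xE xc; rewrite cx /=.
by case Mb: (M (nbreak M (row x)).+1 (row x)) => /=; rewrite ?addn1 // addn0 Mb.
Qed.

(** A lost cell lies in a row with a break, one per break, so there are at most [k - 1]. By
    minimality of [(a, b)], the lost inside chords are [(a, b)] itself and chords of length at most
    [k] ending at [b]: at most [k + 1]. *)
Lemma size_lost : count lost E <= 2 * k.
Proof.
rewrite -size_filter -(count_predC (fun x => toR x || toL x)) -!size_filter.
have h1 : size [seq x <- [seq x <- E | lost x] | toR x || toL x] <=
    size (iota 1 k.-1).
  apply: (size_injS _ _ (fun x => idx (row x))).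
  - by rewrite !filter_uniq.
  - move=> x y; rewrite !mem_filter => /and3P[xc xl xE] /and3P[yc yl yE] exy.
    have rx := lost_row _ xE xc xl; have ry := lost_row _ yE yc yl.
    have exy' : row x = row y.
      have H r r' : idx r = (nbreak M r).+1 -> idx r' = (nbreak M r').+1 ->
          idx r = idx r' -> ~~ (r < r').
        by move=> h h'; rewrite h h' => -[e]; apply/negP => /(nbreak_le M); rewrite h e ltnn.
      have := H _ _ rx ry exy; have := H _ _ ry rx (esym exy).
      by rewrite -!leqNgt => h h'; apply/eqP; rewrite eqn_leq h h'.
    rewrite -(chordK x) // -(chordK y) // exy'; congr chord; congr pair.
    by move: xl yl; rewrite /lost xc yc exy' => /eqP-> /eqP->.
  move=> x; rewrite !mem_filter => /and3P[xc xl xE].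
  by have := lost_row _ xE xc xl; have := nbreak_lt (row x).+1; rewrite mem_iota; lia.
have h2 : size [seq x <- [seq x <- E | lost x] | predC (fun x => toR x || toL x) x] <=
    size ((a, b) :: [seq (b - j, b) | j <- iota 1 k]).
  apply: uniq_leq_size; first by rewrite !filter_uniq.
  have H (s t : nat) : (s, t) \in E -> inside (s, t) -> t = b ->
      (s, t) \in (a, b) :: [seq (b - j, b) | j <- iota 1 k].
    move=> stE /andP[/= ax _] e; have /= lst := bE _ stE.
    rewrite inE; case: (leqP t (s + k)) => lx; last by rewrite (abmin (s, t)) ?eqxx //= e.
    apply/orP; right; apply/mapP; exists (b - s); first by rewrite mem_iota; lia.
    by congr pair; lia.
  case=> s t; rewrite !mem_filter => /and3P[/negbTE /= xc xl xE].
  by move: xl; rewrite /lost xc => /andP[si /eqP e]; apply: H.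
by apply: leq_trans (leq_add h1 h2) _; rewrite size_iota /= size_map size_iota; lia.
Qed.

(** This is where the length of [(a, b)] enters: an unchanged column is at most [idx (row x) < k],
    so it still fits when the interval loses a vertex. *)
Lemma shiftc_bounds (x : nat * nat) : x \in E -> toR x || toL x -> ~~ lost x ->
  0 < shiftc (col x) (row x) < (b - a).-1.
Proof.
move=> xE xc; rewrite /lost xc /shiftc; have := nbreak_lt (row x).+1.
move: xc; rewrite /col /isR /isL; do 2 case: ifP; lia.
Qed.

Lemma contract_bounds (x : nat * nat) : x \in E -> ~~ lost x ->
  (contract x).1 < (contract x).2 < K.-1.
Proof.
move=> xE xl; have := bE x xE; rewrite /contract; case: ifP => xR.
  by have := shiftc_bounds x xE _ xl; rewrite xR /= => /(_ isT); move: xR; rewrite /isR; lia.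
case: ifP => xL.
  have := shiftc_bounds x xE _ xl; rewrite xL orbT /= => /(_ isT).
  by have /= := bE _ abE; move: xL; rewrite /isL; lia.
have /= := bE _ abE.
case: ifP => xi; first by move: xl; rewrite /lost xR xL xi /=; move: xi; rewrite /isI; lia.
move: xR xL xi; rewrite /= /shiftv /isR /isL /isI; do 2 case: ifP; lia.
Qed.

(** The type of a chord can be read off its image, with [b.-1] in place of [b]; injectivity can then
    be checked type by type. *)
Lemma contract_type (x : nat * nat) : x \in E -> ~~ lost x ->
  [/\ isR b.-1 (contract x) = toR x, isL b.-1 (contract x) = toL x
    & isI b.-1 (contract x) = inside x].
Proof.
move=> xE xl; have := bE _ xE; have /= abK := bE _ abE.
have := shiftc_bounds x xE.
rewrite /contract; case: (boolP (toR x)) => [xR /(_ isT xl) sx bx|xR].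
  by move: xR; rewrite /isR /isL /isI /= => xR; split; lia.
case: (boolP (toL x)) => [xL /(_ isT xl) sx bx|xL _ bx].
  by move: xL; rewrite /isR /isL /isI /= => xL; split; lia.
move: xl; rewrite /lost (negbTE xR) (negbTE xL) /=; move: xR xL bx.
case: x {xE} => s t; rewrite /isR /isL /isI /shiftv /=; case: ifP => xi /= xR xL bx xl.
  by split; lia.
by split; move: xR xL xi; do 2 case: ifP; lia.
Qed.

Lemma contract_inj (x y : nat * nat) : x \in E -> ~~ lost x -> y \in E -> ~~ lost y ->
  contract x = contract y -> x = y.
Proof.
move=> xE xl yE yl e.
have bx := bE x xE; have by_ := bE y yE.
have [xR' xL' xI'] := contract_type x xE xl.
have [] := contract_type y yE yl; rewrite -e xR' xL' xI' => eR eL eI.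
case: (boolP (toR x || toL x)) => xc.
  have yc : toR y || toL y by rewrite -eR -eL.
  have sx := shiftc_bounds x xE xc xl; have sy := shiftc_bounds y yE yc yl.
  move: xl yl; rewrite /lost xc yc => xl yl.
  rewrite -(chordK x) // -(chordK y) //.
  have [er es] : row x = row y /\ shiftc (col x) (row x) = shiftc (col y) (row y).
    move: e sx sy; rewrite /contract /row -eR -eL.
    move: (shiftc _ _) (shiftc _ _) => c d; case: (boolP (toR x)) => [xR|xR].
      have : toR y by rewrite -eR.
      move: xR; rewrite /isR; case: (x) => ? ?; case: (y) => ? ? /=.
      by clear; move=> xR yR [? ?] sx sy; split; lia.
    by move: xc; rewrite (negbTE xR) /= => -> [-> /addnI ->].
  rewrite er; congr chord; congr pair.
  move: es xl yl; rewrite er /shiftc; move: (idx _) (col x) (col y) => i u v.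
  by clear; do 2 case: ifP; lia.
move: e; rewrite /contract -eR -eL -eI; move: xc eR eL eI; rewrite negb_or => /andP[xR xL].
rewrite (negbTE xR) (negbTE xL); case: ifP => // xI eR eL eI.
case: x y xR xL xI bx by_ eR eL eI {xE xl yE yl xR' xL' xI'} => s t [s' t'].
rewrite /isR /isL /isI /shiftv /= => xR xL xI bx by_ eR eL eI [e1 e2].
have -> : s = s' by move: e1; do 2 case: ifP; lia.
by have -> : t = t' by move: e2; do 2 case: ifP; lia.
Qed.

Definition newcell (x : nat * nat) := (shiftc (col x) (row x), row x).

Lemma delM_newcell (x : nat * nat) : x \in E -> toR x || toL x -> ~~ lost x ->
  0 < (newcell x).1 /\ delM M (newcell x).1 (newcell x).2.
Proof.
move=> xE xc xl; have /andP[x0 _] := shiftc_bounds x xE xc xl; split=> //.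
have := M_cell x xE xc; move: xl; rewrite /delM /newcell /shiftc /lost xc [fst _]/= [snd _]/=.
case: (leqP (col x) (idx (row x))) => h1 h2; first by rewrite h1.
have -> : ((col x).-1 <= idx (row x)) = false by lia.
by rewrite prednK //; lia.
Qed.

Lemma cross_newcell (x y : nat * nat) : x \in E -> y \in E -> toR x || toL x ->
  toR y || toL y -> ~~ lost x -> ~~ lost y ->
  cross (contract x) (contract y) -> lt2 (newcell x) (newcell y) || lt2 (newcell y) (newcell x).
Proof.
move=> xE yE xc yc xl yl; have bx := bE x xE; have by_ := bE y yE.
have := shiftc_bounds x xE xc xl; have := shiftc_bounds y yE yc yl.
rewrite /contract /newcell /lt2 /=.
move: (shiftc _ _) (shiftc _ _) => c d.
rewrite /row; case: x y xc yc bx by_ {xE yE xl yl} => s t [s' t'] xc yc bx by_.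
case: (boolP (toR (s, t))) xc => [xR _|_ /= xL];
  case: (boolP (toR (s', t'))) yc => [yR _|_ /= yL];
  [move: xR yR | rewrite yL; move: xR yL | rewrite xL; move: xL yR
  | rewrite xL yL; move: xL yL];
  by move: bx by_; clear; rewrite /isR /isL /cross /=; lia.
Qed.

(** A chord [z] with no end strictly between [a] and [b] crosses a cell exactly when the row of the
    cell is strictly between the rows of the ends of [z]. The column is irrelevant, so the row
    bounds in [lift_chain] preserve these crossings. *)
Definition row_lo (z : nat * nat) :=
  if b <= z.1 then z.1 else if b <= z.2 then z.2 else K + z.1.
Definition row_hi (z : nat * nat) :=
  if b <= z.1 then z.2 else if b <= z.2 then K + z.1 else K + z.2.

Lemma cross_outside (x z : nat * nat) : x \in E -> toR x || toL x -> z \in E ->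
  ~~ (toR z || toL z) -> ~~ inside z -> row_lo z < row x < row_hi z -> cross x z.
Proof.
move=> xE xc zE zc zi; have := bE x xE; have := bE z zE; move: xc zc zi.
case: x z {xE zE} => s t [s' t'].
rewrite negb_or /row_lo /row_hi /row; case: (boolP (toR (s, t))) => [+ _|_ /= ];
 rewrite /isR /isL /isI /cross /=; repeat case: ifP; lia.
Qed.

Lemma contract_outside (x z : nat * nat) : x \in E -> toR x || toL x -> ~~ lost x ->
  z \in E -> ~~ (toR z || toL z) -> ~~ inside z ->
  cross (contract x) (contract z) -> row_lo z < row x < row_hi z.
Proof.
move=> xE xc xl zE zc zi; have := bE x xE; have := bE z zE.
have := shiftc_bounds x xE xc xl; move: xc zc zi.
rewrite /contract negb_or /row_lo /row_hi /row /shiftv; move: (shiftc _ _) => c.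
case: x z {xE xl zE} => s t [s' t'] xc /andP[zR zL] zi.
rewrite (negbTE zR) (negbTE zL) (negbTE zi); move: xc zR zL zi.
case: (boolP (toR (s, t))) => [+ _|_ /= xL]; [|rewrite xL; move: xL];
  clear; rewrite /isR /isL /isI /cross /=; repeat case: ifP; lia.
Qed.

Lemma contract_outside2 (x z : nat * nat) : ~~ (toR x || toL x) -> ~~ inside x ->
  ~~ (toR z || toL z) -> ~~ inside z ->
  cross (contract x) (contract z) -> cross x z.
Proof.
move=> xc xi zc zi; move: xc zc.
rewrite /contract !negb_or => /andP[xR xL] /andP[zR zL].
rewrite (negbTE xR) (negbTE xL) (negbTE xi) (negbTE zR) (negbTE zL) (negbTE zi).
have mono v w : shiftv v < shiftv w -> v < w by clear; rewrite /shiftv; do 2 case: ifP; lia.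
by move=> /orP[]/and3P[/mono h1 /mono h2 /mono h3]; rewrite /cross h1 h2 h3 ?orbT.
Qed.

(** A crossing family of [k + 1] contracted chords contains no inside chord: a kept one is unmoved
    and of length at most [k], against [cross_size]. Its cells form a chain of [delM], which
    [lift_chain] turns into a chain of [M] at least as long; with the original outside chords this
    contradicts [cE]. *)
Lemma contract_crossfree : crossfree k [seq contract x | x <- E & ~~ lost x].
Proof.
move=> c' pc' sub; rewrite leqNgt; apply/negP => sc.
have [c ec subc] := subset_map_lift _ _ _ _ _ sub.
have cEl (x : nat * nat) : x \in c -> x \in E /\ ~~ lost x.
  by move=> /subc; rewrite mem_filter => /andP[].
have long (x : nat * nat) : x \in c -> ~~ inside x.
  move=> xc; have [xE xl] := cEl x xc; apply/negP => xi.
  have kx : contract x = x.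
    have xR : toR x = false by move: xi; clear; rewrite /isR /isI; lia.
    have xL : toL x = false by move: xi; clear; rewrite /isL /isI; lia.
    by rewrite /contract xR xL xi.
  have xc' : x \in c' by rewrite -kx ec map_f.
  have /andP[x12 _] := bE x xE.
  have := cross_size c' x pc' xc' x12 => sx.
  have ex := abmin x xE; move: (xi) => /andP[/ex{}ex /ex{}ex].
  have xab : x = (a, b) by apply: ex; lia.
  by move: xl; rewrite /lost xab /isR /isL /isI /= !ltnn /= !leqnn eqxx.
move: pc' sc; rewrite ec pairwise_map size_map => pc sc.
pose P (x : nat * nat) := toR x || toL x.
have cP (x y : nat * nat) : x \in c -> y \in c -> x != y -> cross (contract x) (contract y).
  exact: (pairwise_sym_in _ (relpre contract cross) c x y (fun u v => cross_sym _ _) pc).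
have uc : uniq c by apply: pairwise_irr_uniq pc => x; apply: cross_irr.
pose c1 := sort (relpre row leq) (filter P c).
have c1P (x : nat * nat) : x \in c1 -> [/\ x \in c, P x, x \in E & ~~ lost x].
  by rewrite mem_sort mem_filter => /andP[px xc]; have [] := cEl x xc.
have pc1 : pairwise lt2 (map newcell c1).
  rewrite pairwise_map; apply: (pairwise_sub_in _ _ (relpre row leq)).
  - rewrite -sorted_pairwise; first by apply: sort_sorted => x y; apply: leq_total.
    by move=> y x z /=; apply: leq_trans.
  - by rewrite sort_uniq filter_uniq.
  move=> x y /c1P[xc xP xE xl] /c1P[yc yP yE yl] xy /= rxy.
  have := cross_newcell x y xE yE xP yP xl yl (cP x y xc yc xy).
  by rewrite /lt2 /= => /orP[//|/andP[_]]; rewrite ltnNge rxy.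
have [||d [pd sd dM dB]] := lift_chain M (map newcell c1).
- exact: pc1.
- by move=> q /mapP[x /c1P[_ xP xE xl] ->]; apply: delM_newcell.
pose c2 := filter (predC P) c.
have c2P (x : nat * nat) : x \in c2 -> [/\ x \in c, ~~ P x & x \in E].
  by rewrite mem_filter => /andP[px xc]; have [] := cEl x xc.
have dc (q : nat * nat) : q \in d -> [/\ chord q \in E, P (chord q) & row (chord q) = q.2].
  by move=> /dM/M_chord[].
have : size (map chord d ++ c2) <= k.
  apply: cE => [|x]; last first.
    by rewrite mem_cat => /orP[/mapP[q /dc[? _ _] ->]|/c2P[]].
  rewrite pairwise_cat; apply/and3P; split.
  - apply/allrelP => x z /mapP[q qd ->] zc2; have [qE qP qr] := dc q qd.
    have [zc zP zE] := c2P z zc2; apply: cross_outside => //; first exact: long.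
    (* All cells of the family cross [z] after contraction, so their rows lie in the row interval of
       [z]; the lifted chain inherits these bounds. The column bound 0 is vacuous. *)
    rewrite qr; have [] := dB 0 (row_lo z).+1 (row_hi z).-1 _ q qd; last by clear; lia.
    move=> y /mapP[w /c1P[wc wP wE wl] ->]; split=> //=.
    have wz : w != z by apply: contraNneq zP => <-.
    have := contract_outside w z wE wP wl zE zP (long z zc) (cP w z wc zc wz).
    by clear; lia.
  - rewrite pairwise_map; apply: (pairwise_sub_in _ _ lt2) => //.
      by apply: (pairwise_irr_uniq _ lt2) => // q; rewrite /lt2 ltnn.
    move=> q q' qd q'd _ qq'.
    have [qE qP cq rq] := M_chord _ (dM q qd); have [qE' qP' cq' rq'] := M_chord _ (dM q' q'd).
    by apply: cross_lt2 => //; rewrite cq rq cq' rq'; exact: qq'.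
  apply: (pairwise_sub_in _ _ (relpre contract cross)).
  - exact: pairwise_filter.
  - exact: filter_uniq.
  move=> x z /c2P[xc xP xE] /c2P[zc zP zE] _ /=.
  by apply: contract_outside2 => //; exact: long.
rewrite size_cat size_map leqNgt => /negP; apply.
rewrite (leq_trans sc) // -(count_predC P c) -!size_filter leq_add2r.
by rewrite size_map size_sort in sd.
Qed.

End Step.

Theorem line_bound (N k : nat) (E : seq (nat * nat)) : uniq E ->
  (forall x : nat * nat, x \in E -> x.1 < x.2 <= N) -> crossfree k E -> size E <= 2 * k * N.
Proof.
case: k => [|k] uE bE cE.
  case: E {uE bE} cE => // x E cE.
  have : {subset [:: x] <= x :: E} by move=> y; rewrite !inE => ->.
  by move=> /(cE [:: x] isT).
elim: N E uE bE cE => [|N IH] E uE bE cE.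
  by case: E bE {uE cE} => // x E /(_ x (mem_head _ _)); lia.
pose long (x : nat * nat) := (x \in E) && (x.1 + k.+1 < x.2).
case: (boolP (has long E)) => [/hasP[x0 x0E x0l]|/hasPn nl]; last first.
  have : size E <= size [seq (s, s + j) | s <- iota 0 N.+1, j <- iota 1 k.+1].
    apply: uniq_leq_size => // -[s t] stE; have h1 : s < t <= N.+1 := bE _ stE.
    have h2 : ~~ (s + k.+1 < t) by have := nl _ stE; rewrite /long stE.
    apply/allpairsPdep; exists s, (t - s); rewrite !mem_iota.
    by split; [lia | lia | congr pair; lia].
  rewrite size_allpairs !size_iota; nia.
have [a [b [abE abl abmin]]] : exists a b, [/\ (a, b) \in E, a + k.+1 < b &
    forall x : nat * nat, x \in E -> x.1 + k.+1 < x.2 -> b - a <= x.2 - x.1].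
  have ex : exists m, has (fun x => long x && (x.2 - x.1 == m)) E.
    by exists (x0.2 - x0.1); apply/hasP; exists x0; rewrite ?x0l ?eqxx.
  case: (ex_minnP ex) => m /hasP[[a b] abE /andP[/andP[_ abl] /eqP em]] mmin.
  exists a, b; split=> // x xE xl; rewrite [b - a]em; apply: mmin.
  by apply/hasP; exists x => //; rewrite /long xE xl eqxx.
(* [N.+2] plays the role of [K]: it exceeds every vertex, so the rows of the two kinds of cells do
   not overlap. *)
have bE' (x : nat * nat) : x \in E -> x.1 < x.2 < N.+2 by move=> /bE.
have abmin' (x : nat * nat) : x \in E -> a <= x.1 -> x.2 <= b -> x.1 + k.+1 < x.2 -> x = (a, b).
  by move=> xE ax xb xl; have := abmin x xE xl; case: x ax xb {xE} xl => s t /= *; congr pair; lia.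
have k0 : 0 < k.+1 by [].
pose E' := [seq contract N.+2 a b E x | x <- E & ~~ lost N.+2 a b E x].
have sE' : size E' <= 2 * k.+1 * N.
  apply: IH.
  - rewrite map_inj_in_uniq ?filter_uniq // => x y.
    rewrite !mem_filter => /andP[xl xE] /andP[yl yE].
    exact: (contract_inj k.+1 N.+2).
  - move=> _ /mapP[x + ->]; rewrite mem_filter => /andP[xl xE].
    exact: (contract_bounds k.+1 N.+2).
  exact: contract_crossfree.
have sl := size_lost k.+1 N.+2 a b E k0 uE cE bE' abE abl abmin'.
rewrite size_map size_filter in sE'.
by rewrite -(count_predC (lost N.+2 a b E)) mulnS; apply: leq_add sl sE'.
Qed.

(** * Periodic families *)

(** Chords are listed by increasing left ends, so that crossing families can be spliced by index. *)
Definition kcross (G : rel nat) (m : nat) (s t : nat -> nat) :=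
  (forall i, i < m -> G (s i) (t i)) /\
  (forall i j, i < j -> j < m -> [/\ s i < s j, s j < t i & t i < t j]).

Definition over (m h : nat) (s t : nat -> nat) := forall i, i < m -> s i < h < t i.

Definition periodic (p : nat) (G : rel nat) := forall s t, G (s + p) (t + p) = G s t.

Definition bounded (p : nat) (G : rel nat) := forall s t, G s t -> s < t <= s + p.

Definition nokcross (m : nat) (G : rel nat) := forall s t, ~ kcross G m s t.

Lemma periodicM p G j s t : periodic p G -> G (s + j * p) (t + j * p) = G s t.
Proof.
move=> pG; elim: j => [|j IH]; first by rewrite !addn0.
by rewrite mulSn [p + _]addnC !addnA pG.
Qed.

Lemma kcross_le G m s t i j : kcross G m s t -> i <= j -> j < m ->
  s i <= s j /\ t i <= t j.
Proof.
move=> [_ cG]; rewrite leq_eqVlt => /orP[/eqP->//|ij] jm.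
by have [? _ ?] := cG i j ij jm; split; apply: ltnW.
Qed.

Lemma nokcross_crossfree k G (E : seq (nat * nat)) : nokcross k.+1 G ->
  (forall x : nat * nat, x \in E -> G x.1 x.2) -> crossfree k E.
Proof.
move=> nG EG c pc cE; rewrite leqNgt; apply/negP => kc.
pose r : rel (nat * nat) := relpre fst leq.
pose c' := sort r c.
have sc' : sorted r c' by apply: sort_sorted => x y; apply: leq_total.
have rtr : transitive r by move=> y x z; apply: leq_trans.
have uc := pairwise_irr_uniq _ _ _ cross_irr pc.
have sz : size c' = size c by rewrite size_sort.
have mem i : i < k.+1 -> nth (0, 0) c' i \in c.
  by move=> ik; rewrite -(mem_sort r); apply: mem_nth; rewrite sz; apply: leq_trans kc.
apply: (nG (fun i => (nth (0, 0) c' i).1) (fun i => (nth (0, 0) c' i).2)).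
split=> [i ik|i j ij jk]; first exact/EG/cE/mem.
have ik := ltn_trans ij jk.
have le1 : r (nth (0, 0) c' i) (nth (0, 0) c' j).
  apply: (sorted_ltn_nth rtr) => //; rewrite ?inE sz; exact: leq_trans kc.
have ne : nth (0, 0) c' i != nth (0, 0) c' j.
  rewrite nth_uniq ?sort_uniq // ?sz; [by rewrite neq_ltn ij | exact: leq_trans kc..].
have := pairwise_sym_in _ _ _ _ _ cross_sym pc (mem i ik) (mem j jk) ne.
move: le1; rewrite /r /cross /= leqNgt => /negbTE h /orP[/and3P[? ? ?]|]; first by split.
by rewrite h.
Qed.

Section Periodic.
Variables (p k : nat).
Hypotheses (p0 : 0 < p) (k0 : 0 < k).

Section Fixed.
Variable G : rel nat.
Hypotheses (pG : periodic p G) (bG : bounded p G).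

(** Vertices are naturals, so translating to the left needs care: a chord over [h] has length at
    most [p] and starts beyond [h - p], and [p <= T] keeps its translate nonnegative. *)
Lemma over_translate m s t h T : kcross G m s t -> over m h s t ->
  h = T %[mod p] -> p <= T -> exists s' t', kcross G m s' t' /\ over m T s' t'.
Proof.
move=> [sG sc] oh hT pT; have dh := divn_eq h p; have dT := divn_eq T p.
case: (leqP (h %/ p) (T %/ p)) => hd.
  have [j ej] : exists j, T = h + j * p.
    exists (T %/ p - h %/ p); rewrite {1}dT {1}dh hT mulnBl.
    have := leq_mul2r p (h %/ p) (T %/ p); rewrite hd orbT; lia.
  exists (fun i => s i + j * p), (fun i => t i + j * p); split; last first.
    by move=> i im; have := oh i im; lia.
  split=> [i im|i l il lm]; first by rewrite periodicM ?sG.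
  by have [? ? ?] := sc i l il lm; split; lia.
have [j ej] : exists j, h = T + j * p.
  exists (h %/ p - T %/ p); rewrite {1}dT {1}dh hT mulnBl.
  have := leq_mul2r p (T %/ p) (h %/ p); rewrite (ltnW hd) orbT; lia.
have sj i : i < m -> j * p <= s i.
  by move=> im; have := oh i im; have := bG _ _ (sG i im); lia.
have tj i : i < m -> j * p <= t i.
  by move=> im; have := oh i im; have := sj i im; lia.
exists (fun i => s i - j * p), (fun i => t i - j * p); split; last first.
  by move=> i im; have := oh i im; have := sj i im; lia.
split=> [i im|i l il lm].
  by rewrite -(periodicM p G j) // !subnK ?sG ?sj ?tj.
have := sj i (ltn_trans il lm); have := sj l lm.
by have [? ? ?] := sc i l il lm; split; lia.
Qed.

Hypothesis nG : nokcross k.+1 G.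

(* [s, t] is a k-crossing whose first [j] chords have length [p], and [a, b] is a
   k-crossing over the end of its chord number [j]. *)
Section Progress.
Variables (j : nat) (s t a b : nat -> nat).
Hypotheses (jk : j < k) (cX : kcross G k s t) (hubX : forall l, l < j -> t l = s l + p).
Hypotheses (cP : kcross G k a b) (oP : over k (t j) a b).

(** Otherwise X_j, ..., X_(j+i), P_i, ..., P_(k-1) would be [k + 1] crossing chords; they overlap
    because P lies over [t j]. *)
Lemma no_splice i : i < k - j -> s (j + i) < a i -> t (j + i) < b i -> False.
Proof.
move=> ik sa tb.
pose f (x y : nat -> nat) l := if l <= i then x (j + l) else y l.-1.
apply: (nG (f s a) (f t b)); have [GX crX] := cX; have [GP crP] := cP.
split=> [l lk|l m lm mk]; rewrite /f.
  by case: leqP => li; [apply: GX | apply: GP]; lia.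
case: (leqP l i) => li; case: (leqP m i) => mi.
- by apply: crX; lia.
- have jlk : j + i < k by lia.
  have [h1 h2] : s (j + l) <= s (j + i) /\ t (j + l) <= t (j + i).
    by apply: (kcross_le G k); rewrite ?leq_add2l.
  have mk' : m.-1 < k by lia.
  have [h3 h4] : a i <= a m.-1 /\ b i <= b m.-1 by apply: (kcross_le G k) => //; lia.
  have [_ h5] : s j <= s (j + l) /\ t j <= t (j + l).
    by apply: (kcross_le G k); rewrite ?leq_addr //; lia.
  by have := oP m.-1 mk'; split; lia.
- by lia.
- by apply: crP; lia.
Qed.

(** X_j, ..., X_(j+i) are replaced by P_0, ..., P_i. The new chords start to the right of the
    earlier ones, since those have length exactly [p] and the new ones end later with length at most
    [p]. *)
Lemma splice i : i < k - j -> a 0 <= s j -> a i <= s (j + i) ->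
    (j + i.+1 < k -> b i < t (j + i.+1)) ->
  exists s' t', [/\ kcross G k s' t', forall l, l < j -> s' l = s l /\ t' l = t l,
    s' j <= s j & t j < t' j].
Proof.
move=> ik a0 ai bi; have [GX crX] := cX; have [GP crP] := cP.
pose f (x y : nat -> nat) l := if (l < j) || (j + i < l) then x l else y (l - j).
have ijk : j + i < k by lia.
have fj : (j < j) || (j + i < j) = false by lia.
exists (f s a), (f t b); split; last 1 first.
- by rewrite /f fj subnn; have := oP 0 k0; lia.
- split=> [l lk|l m lm mk]; rewrite /f.
    by case: ifP => _; [apply: GX | apply: GP; lia].
  have lk := ltn_trans lm mk.
  case: (boolP ((l < j) || (j + i < l))) => hl; case: (boolP ((m < j) || (j + i < m))) => hm.
  + exact: crX.
  + have lj : l < j by lia.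
    have mjk : m - j < k by lia.
    have [_ h1 h2] := crX l j lj jk; have h3 := hubX l lj.
    have := bG _ _ (GP _ mjk); have := oP _ mjk.
    have [h4 _] : a (m - j) <= a i /\ b (m - j) <= b i by apply: (kcross_le G k) => //; lia.
    have [_ h5 _] : [/\ s l < s (j + i), s (j + i) < t l & t l < t (j + i)] by apply: crX; lia.
    by split; lia.
  + have jil : j + i.+1 <= m by lia.
    have h1 := bi (leq_ltn_trans jil mk).
    have [h2 _] : a (l - j) <= a i /\ b (l - j) <= b i by apply: (kcross_le G k) => //; lia.
    have [_ h3] : a (l - j) <= a i /\ b (l - j) <= b i by apply: (kcross_le G k) => //; lia.
    have [_ h4] : s (j + i.+1) <= s m /\ t (j + i.+1) <= t m by apply: (kcross_le G k).
    have [h5 _ _] : [/\ s (j + i) < s m, s m < t (j + i) & t (j + i) < t m] by apply: crX; lia.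
    have [_ h6 _] : [/\ s j < s m, s m < t j & t j < t m] by apply: crX; lia.
    have ljk : l - j < k by lia.
    by have := oP _ ljk; split; lia.
  + by apply: crP; lia.
- by move=> l lj; rewrite /f lj.
by rewrite /f fj subnn.
Qed.

(* Exchange between the maximum chains X and P: if P_i could precede X_(j+i+1) the
   two could be spliced, and if X_(j+i) preceded P_i they would give a
   (k+1)-crossing; so the left ends of P stay weakly to the left of those of X
   until the splice succeeds. *)
Lemma progress :
  exists s' t', [/\ kcross G k s' t', forall l, l < j -> s' l = s l /\ t' l = t l,
    s' j <= s j & t j < t' j].
Proof.
have a0 : a 0 <= s j.
  rewrite leqNgt; apply/negP => sa; apply: (no_splice 0); rewrite ?addn0 //; first by lia.
  by have := oP 0 k0; lia.
have H i : i < k - j -> a i <= s (j + i) \/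
  (exists s' t', [/\ kcross G k s' t', forall l, l < j -> s' l = s l /\ t' l = t l,
    s' j <= s j & t j < t' j]).
  elim: i => [|i IH] ik; first by left; rewrite addn0.
  have ik' : i < k - j by lia.
  have [ai|] := IH ik'; last by right.
  case: (ltnP (b i) (t (j + i.+1))) => bt; first by right; apply: (splice i).
  left; rewrite leqNgt; apply/negP => sa; apply: (no_splice i.+1 ik sa).
  have [_ crP] := cP; have ik2 : i.+1 < k by lia.
  by have [_ _] := crP i i.+1 (ltnSn i) ik2; apply: leq_ltn_trans.
have lastk : (k - j).-1 < k - j by lia.
have [ai|//] := H _ lastk.
by apply: (splice _ lastk a0 ai); lia.
Qed.

End Progress.

(* Push the ends to the right one after the other: a chord whose right end cannot
   be pushed further may be replaced by the one of length [p] with that end. *)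
Lemma hubs T0 : p <= T0 -> ~~ G T0 (T0 + p) ->
  (forall T, p <= T -> ~~ G T (T + p) -> exists a b, kcross G k a b /\ over k T a b) ->
  exists s t, kcross G k s t /\ forall l, l < k -> t l = s l + p.
Proof.
move=> pT0 nT0 H.
(* The invariant [p <= t 0] keeps all right ends where [H] applies and where subtracting [p] is
   exact. *)
suff C j : j <= k -> exists s t, [/\ kcross G k s t, p <= t 0 &
    forall l, l < j -> t l = s l + p].
  by have [s [t [? _ ?]]] := C k (leqnn k); exists s, t.
elim: j => [|j IH] jk.
  have [s [t [c o]]] := H T0 pT0 nT0; exists s, t; split=> //.
  by have := o 0 k0; lia.
have [s [t [c t0 hb]]] := IH (ltnW jk).
(* Inner induction on how far chord number [j] falls short of length [p]; [progress] strictly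
   lengthens it. *)
have [d] := ubnP (p - (t j - s j)); elim: d s t c t0 hb => // d IHd s t c t0 hb hd.
have [Gc cr] := c.
have [_ tj] := kcross_le G k s t 0 j c isT jk.
have ptj := leq_trans t0 tj; have bj := bG _ _ (Gc j jk).
case: (boolP (G (t j) (t j + p))) => [hub|nhub].
  pose s' l := if l == j then t j - p else s l.
  exists s', t; split=> //; last first.
    move=> l; rewrite ltnS leq_eqVlt /s' => /orP[/eqP->|lj].
      by rewrite eqxx subnK.
    by rewrite ltn_eqF // hb.
  split=> [l lk|l m lm mk]; rewrite /s'.
    case: eqP => [->|_]; last exact: Gc.
    by move: hub; rewrite -{1}(subnK ptj) pG.
  have [? ? ?] := cr l m lm mk.
  case: eqP => [lj|_].
    have -> : (m == j) = false by rewrite lj in lm; rewrite gtn_eqF.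
    by subst l; split=> //; lia.
  case: eqP => [mj|_] //; subst m; have := hb l lm.
  by split=> //; lia.
have [a [b [cP oP]]] := H _ ptj nhub.
have [s' [t' [c' e' sj' tj']]] := progress j s t a b jk c hb cP oP.
have bj' : s' j < t' j <= s' j + p by case: c' => + _; move=> /(_ j jk)/bG.
apply: (IHd s' t') => //.
- case: (posnP j) => [j0|j0]; last by have [_ ->] := e' 0 j0.
  by subst j; lia.
- by move=> l lj; have [-> ->] := e' l lj; apply: hb.
by lia.
Qed.

(** If every vertex from [p] on had a [k]-crossing over it, [progress] with [j = 0] would lengthen
    the first chord forever, beyond the bound [p]. *)
Lemma free_cut : exists2 T, p <= T & forall a b, kcross G k a b -> ~ over k T a b.
Proof.
apply: NNPP => nT.
have H T : p <= T -> exists a b, kcross G k a b /\ over k T a b.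
  move=> pT; apply: NNPP => nab; apply: nT; exists T => // a b c o.
  by apply: nab; exists a, b.
have C d : exists s t, [/\ kcross G k s t, p <= t 0 & d <= t 0 - s 0].
  elim: d => [|d [s [t [c t0 hd]]]].
    have [s [t [c o]]] := H p (leqnn p); exists s, t; split=> //.
    by have := o 0 k0; lia.
  have [a [b [cP oP]]] := H _ t0.
  have [s' [t' [c' _ ? ?]]] := progress 0 s t a b k0 c (fun l => ltac:(by [])) cP oP.
  have := bG _ _ (proj1 c 0 k0).
  by exists s', t'; split=> //; lia.
have [s [t [[c _] _ h]]] := C p.+1.
by have := bG _ _ (c 0 k0); lia.
Qed.

(** A hub is a chord of length [p]; its whole orbit is added to keep the family periodic. *)
Definition add_hub T : rel nat :=
  fun s t => G s t || (t == s + p) && (s == T %[mod p]).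

Lemma add_hub_periodic T : periodic p (add_hub T).
Proof. by move=> s t; rewrite /add_hub pG modnDr eqn_add2r. Qed.

Lemma add_hub_bounded T : bounded p (add_hub T).
Proof. by move=> s t /orP[/bG //|/andP[/eqP-> _]]; rewrite leqnn -addn1 leq_add2l p0. Qed.

(* Chords crossing a new chord do so at one of its two ends; translating those at
   the left end by [p] gathers all of them over the right end. *)
Lemma add_hub_nokcross T : p <= T ->
  (forall a b, kcross G k a b -> ~ over k T a b) -> nokcross k.+1 (add_hub T).
Proof.
move=> pT nT s t [sG sc].
case: (classic (exists2 i, i < k.+1 & ~~ G (s i) (t i))) => [[i ik nGi]|allG]; last first.
  apply: (nG s t); split=> // i ik; apply: contraT => nGi; case: allG; by exists i.
have hub l : l < k.+1 -> ~~ G (s l) (t l) -> t l = s l + p /\ s l = T %[mod p].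
  by move=> lk /negbTE nGl; have := sG l lk; rewrite /add_hub nGl /= => /andP[/eqP ? /eqP ?].
have [ti si] := hub i ik nGi.
(* Left ends in one orbit differ by multiples of [p], too far apart for hubs to cross; so only chord
   [i] is new. *)
have GX l : l < k.+1 -> l != i -> G (s l) (t l).
  move=> lk li; apply: contraT => nGl; have [tl sl] := hub l lk nGl.
  have : s l == s i %[mod p] by apply/eqP; rewrite sl si.
  move: li; rewrite neq_ltn => /orP[li|li].
    have [h1 h2 _] := sc l i li ik; rewrite eq_sym eqn_mod_dvd ?(ltnW h1) //.
    by move=> /dvdn_leq; lia.
  have [h1 h2 _] := sc i l li lk; rewrite eqn_mod_dvd ?(ltnW h1) //.
  by move=> /dvdn_leq; lia.
pose s' l := if l < k - i then s (i + l.+1) else s (l - (k - i)) + p.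
pose t' l := if l < k - i then t (i + l.+1) else t (l - (k - i)) + p.
have c' : kcross G k s' t'.
  split=> [l lk|l m lm mk]; rewrite /s' /t'.
    by case: ifP => hl; rewrite ?pG; apply: GX; lia.
  case: (ltnP l (k - i)) => hl; case: (ltnP m (k - i)) => hm.
  - by apply: sc; lia.
  - have [h1 h2 h3] : [/\ s i < s (i + l.+1), s (i + l.+1) < t i & t i < t (i + l.+1)].
      by apply: sc; lia.
    have m'i : m - (k - i) < i by lia.
    have [h4 h5 h6] := sc _ _ m'i ik.
    have [h7 h8 h9] : [/\ s (m - (k - i)) < s (i + l.+1), s (i + l.+1) < t (m - (k - i)) &
        t (m - (k - i)) < t (i + l.+1)] by apply: sc; lia.
    have bm : t (m - (k - i)) <= s (m - (k - i)) + p.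
      by have /bG/andP[] : G (s (m - (k - i))) (t (m - (k - i))) by apply: GX; lia.
    have bl : t (i + l.+1) <= s (i + l.+1) + p.
      by have /bG/andP[] : G (s (i + l.+1)) (t (i + l.+1)) by apply: GX; lia.
    by split; lia.
  - by lia.
  - have [h1 h2 h3] : [/\ s (l - (k - i)) < s (m - (k - i)), s (m - (k - i)) < t (l - (k - i)) &
        t (l - (k - i)) < t (m - (k - i))] by apply: sc; lia.
    by split; lia.
have o' : over k (s i + p) s' t'.
  move=> l lk; rewrite /s' /t'; case: (ltnP l (k - i)) => hl.
    have [h1 h2 h3] : [/\ s i < s (i + l.+1), s (i + l.+1) < t i & t i < t (i + l.+1)].
      by apply: sc; lia.
    by lia.
  have [h1 h2 h3] : [/\ s (l - (k - i)) < s i, s i < t (l - (k - i)) & t (l - (k - i)) < t i].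
    by apply: sc; lia.
  by lia.
have [|a [b [ca oa]]] := over_translate _ _ _ _ T c' o' _ pT; first by rewrite modnDr.
exact: nT ca oa.
Qed.

End Fixed.

Definition nhubs (G : rel nat) := count (fun c => G c (c + p)) (iota 0 p).

(** Adding an orbit raises [nhubs]. When no orbit can be added, either every residue has a hub and
    [k <= p] concludes, or [hubs] gives [k] crossing hubs; their left ends differ by less than [p],
    hence lie in distinct orbits. *)
Lemma saturate (G : rel nat) : k <= p -> periodic p G -> bounded p G -> nokcross k.+1 G ->
  exists G' : rel nat, [/\ periodic p G', bounded p G', nokcross k.+1 G',
    (forall s t, G s t -> G' s t) & k <= nhubs G'].
Proof.
move=> kp; have [n] := ubnP (p - nhubs G); elim: n G => // n IH G hn pG bG nG.
have hubmod T : G T (T + p) = G (T %% p) (T %% p + p).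
  by rewrite -(periodicM p G (T %/ p) (T %% p) (T %% p + p)) // addnAC [T %% p + _ * _]addnC
    -divn_eq.
case: (classic (forall T, p <= T -> ~~ G T (T + p) ->
    exists a b, kcross G k a b /\ over k T a b)) => [H|nH]; last first.
  have [T [pT nGT nT]] : exists T, [/\ p <= T, ~~ G T (T + p) &
      forall a b, kcross G k a b -> ~ over k T a b].
    apply: NNPP => nex; apply: nH => T pT nGT; apply: NNPP => nab.
    by apply: nex; exists T; split=> // a b c o; apply: nab; exists a, b.
  have sub s t : G s t -> add_hub G T s t by rewrite /add_hub => ->.
  have lt : nhubs G < nhubs (add_hub G T).
    rewrite /nhubs.
    have TP : T %% p \in iota 0 p by rewrite mem_iota /= ltn_pmod.
    have cnt q : count q (iota 0 p) = count q (T %% p :: rem (T %% p) (iota 0 p)).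
      exact: (permP (perm_to_rem TP) q).
    rewrite !cnt /= -hubmod (negbTE nGT) /add_hub eqxx modn_mod eqxx orbT add0n add1n ltnS.
    by apply: sub_count => c /= ->.
  have [||||G' [? ? ? sub' ?]] := IH (add_hub G T).
  - by have := count_size (fun c => add_hub G T c (c + p)) (iota 0 p);
      rewrite size_iota -/(nhubs _); lia.
  - exact: add_hub_periodic.
  - exact: add_hub_bounded.
  - exact: add_hub_nokcross.
  by exists G'; split=> // s t /sub/sub'.
exists G; split=> //.
case: (boolP (all (fun c => G c (c + p)) (iota 0 p))) => [|/allPn[c]].
  by rewrite all_count /nhubs size_iota => /eqP->.
rewrite mem_iota => /= cp nGc.
have [|||s [t [[cG cr] st]]] := hubs G pG bG nG (c + p).
- exact: leq_addl.
- by rewrite hubmod modnDr modn_small.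
- exact: H.
rewrite /nhubs -size_filter -(size_iota 0 k).
apply: (size_injS _ _ (fun i => s i %% p)); first exact: iota_uniq.
  have inj i j : i < j -> j < k -> s i %% p = s j %% p -> False.
    move=> ij jk /eqP; have [h1 h2 _] := cr i j ij jk; rewrite st in h2; last exact: ltn_trans jk.
    by rewrite eq_sym eqn_mod_dvd ?(ltnW h1) // => /dvdn_leq; lia.
  move=> i j; rewrite !mem_iota !add0n => /= ik jk e.
  by case: (ltngtP i j) => // ij; [case: (inj i j ij jk e) | case: (inj j i ij ik (esym e))].
move=> i; rewrite mem_filter !mem_iota /= => ik.
by rewrite ltn_pmod // andbT -hubmod -st ?cG.
Qed.

End Periodic.

(** * Arcs of a cycle *)

Definition shift (d : nat) (x : nat * nat) := (x.1 + d, x.2 + d).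

Lemma shift_inj d : injective (shift d).
Proof. by move=> [s t] [s' t'] [/addIn -> /addIn ->]. Qed.

Theorem periodic_bound p k (G : rel nat) (L : seq (nat * nat)) : 0 < k <= p ->
  periodic p G -> (forall s t, G s t -> s < t < s + p) -> nokcross k.+1 G ->
  uniq L -> (forall x : nat * nat, x \in L -> G x.1 x.2 /\ x.1 < p) ->
  size L + k < 2 * k * p.
Proof.
move=> /andP[k0 kp] pG bG nG uL LG; have p0 := leq_trans k0 kp.
have bG0 : bounded p G by move=> s t /bG; lia.
have [G' [pG' bG' nG' sub kh]] := saturate p k p0 k0 G kp pG bG0 nG.
(* With the period doubled, one more orbit fits, contributing a single chord per [2 * p] vertices;
   this odd unit makes the final inequality strict. *)
have pG2 : periodic (2 * p) G' by move=> s t; apply: periodicM.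
have bG2 : bounded (2 * p) G' by move=> s t /bG'; lia.
have p20 : 0 < 2 * p by rewrite muln_gt0.
have [T pT nT] := free_cut (2 * p) k p20 k0 G' bG2 nG'.
have pG3 := add_hub_periodic (2 * p) G' pG2 T.
have nG3 := add_hub_nokcross (2 * p) k p20 k0 G' pG2 bG2 nG' T pT nT.
set G3 := add_hub _ _ _ in pG3 nG3.
pose Hs := [seq (c, c + p) | c <- iota 0 p & G' c (c + p)].
pose Lb := L ++ Hs.
pose L2 := (T %% (2 * p), T %% (2 * p) + 2 * p) :: Lb ++ map (shift p) Lb.
have LbG (x : nat * nat) : x \in Lb -> G' x.1 x.2 /\ x.1 < p.
  rewrite mem_cat => /orP[/LG[/sub ? ?] //|/mapP[c + ->]] /=.
  by rewrite mem_filter mem_iota => /andP[].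
have uLb : uniq Lb.
  rewrite cat_uniq uL map_inj_uniq ?filter_uniq ?iota_uniq // => [|c d [] //].
  rewrite andbT; apply/hasPn => _ /mapP[c _ ->]; apply/negP => /LG[/bG /=]; lia.
have L2G (x : nat * nat) : x \in L2 -> G3 x.1 x.2 /\ x.1 < 2 * p.
  rewrite inE mem_cat => /or3P[/eqP->|/LbG[Gx xp]|/mapP[y /LbG[Gy yp] ->]] /=.
  - by rewrite ltn_pmod //; split=> //; rewrite /G3 /add_hub eqxx modn_mod eqxx orbT.
  - by split; [rewrite /G3 /add_hub Gx | lia].
  - by split; [rewrite /G3 /add_hub pG' Gy | lia].
have uL2 : uniq L2.
  rewrite /= cat_uniq uLb (map_inj_uniq (@shift_inj p)) uLb andbT mem_cat negb_or.
  apply/and3P; split.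
  - apply/andP; split; apply/negP; first by move=> /LbG[/bG' /=]; lia.
    by move=> /mapP[[s t] /LbG[/bG' /= b _] [e1 e2]]; lia.
  - by [].
  by apply/hasPn => _ /mapP[y _ ->]; apply/negP => /LbG[_ /=]; lia.
(* Count over a window of [Q] periods and let [Q] be large. *)
pose W Q := [seq shift (q * (2 * p)) x | q <- iota 0 Q, x <- L2].
have WP Q : Q * size L2 <= 2 * k * (2 * p * Q.+1).
  have -> : Q * size L2 = size (W Q) by rewrite size_allpairs size_iota.
  apply: line_bound.
  - apply: allpairs_uniq => //; first exact: iota_uniq.
    move=> [q x] [q' x'] /allpairsPdep[q1 [x1 [_ x1L [-> ->]]]].
    move=> /allpairsPdep[q2 [x2 [_ x2L [-> ->]]]] /= e.
    have e1 : x1.1 + q1 * (2 * p) = x2.1 + q2 * (2 * p) by move: e => [].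
    have [_ l1] := L2G _ x1L; have [_ l2] := L2G _ x2L.
    have eq : q1 = q2.
      have := congr1 (divn^~ (2 * p)) e1.
      by rewrite /= !divnDMl // !divn_small ?add0n.
    by move: e; rewrite eq => /shift_inj ->.
  - move=> _ /allpairsPdep[q [x [qQ xL ->]]] /=.
    have [Gx xp] := L2G x xL; have := add_hub_bounded _ p20 _ bG2 T _ _ Gx.
    by move: qQ; rewrite mem_iota; nia.
  apply: (nokcross_crossfree k G3) => // _ /allpairsPdep[q [x [_ /L2G[Gx _] ->]]] /=.
  by rewrite periodicM.
have sHs : k <= size Hs by rewrite size_map size_filter.
(* This [Q] exceeds the slack [4kp] of one extra period in [WP], which forces [size L2 <= 4kp]. *)
have := WP (4 * k * p).+1; rewrite /= size_cat size_map size_cat; nia.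
Qed.

Section Arcs.
Variable n : nat.

Definition window (s t : nat) : {set 'I_n} := [set x : 'I_n | has (fun w => w %% n == x) (iota s (t - s))].

Lemma windowP s t (x : 'I_n) : reflect (exists2 w, s <= w < t & w %% n = x) (x \in window s t).
Proof.
rewrite inE; apply: (iffP hasP) => [[w ws /eqP ?]|[w ws ?]]; exists w => //.
- by move: ws; rewrite mem_iota; lia.
- by rewrite mem_iota; lia.
- exact/eqP.
Qed.

Lemma window_arc (i : 'I_n) m : Defs.arc i m = window i (i + m).
Proof.
apply/setP => x; rewrite !inE; apply/existsP/hasP => [[j /eqP e]|[w + /eqP e]].
  by exists (i + j); rewrite ?mem_iota ?addKn ?leq_addr ?ltn_add2l /= ?e.
rewrite mem_iota addKn => /andP[iw wm].
have wi : w - i < m by lia.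
by exists (Ordinal wi); rewrite /= subnKC // e.
Qed.

Lemma window_periodic s t : window (s + n) (t + n) = window s t.
Proof.
by apply/setP => x; rewrite !inE subnDr addnC iotaDl has_map; apply: eq_has => w /=; rewrite modnDl.
Qed.

(** The points [s' - 1] and [t] each lie in one window only: the windows are shorter than [n], so no
    other representative of these residues falls in the wrong one. *)
Lemma window_nsub s t s' t' : s' < t' -> t' < s' + n -> s < t -> t < s + n ->
  s < s' -> s' < t -> t < t' -> ~~ (window s t \subset window s' t') /\ ~~ (window s' t' \subset window s t).
Proof.
move=> h1 h2 h3 h4 h5 h6 h7; have n0 : 0 < n by lia.
have key w a b : ~~ (a <= w < b) -> b <= w + n -> w < a + n -> Ordinal (ltn_pmod w n0) \notin window a b.
  move=> wab bw wa; apply/negP => /windowP[v vab /= e].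
  case: (ltngtP v w) => vw; [| |lia].
    have /dvdn_leq : n %| w - v by rewrite -eqn_mod_dvd ?(ltnW vw) // e.
    by lia.
  have /dvdn_leq : n %| v - w by rewrite -eqn_mod_dvd ?(ltnW vw) // e.
  by lia.
split; apply/negP => /subsetP sub.
  have /sub : Ordinal (ltn_pmod s'.-1 n0) \in window s t by apply/windowP; exists s'.-1; first lia.
  by apply/negP/key; lia.
have /sub : Ordinal (ltn_pmod t n0) \in window s' t' by apply/windowP; exists t; first lia.
by apply/negP/key; lia.
Qed.

End Arcs.

Theorem theorem3p6p1 (n k : nat) (hn : 1 <= n) (F : {set {set 'I_n}})
    (hwide : locally_wide k F)
    (harc : forall U : {set 'I_n}, U \in F -> is_arc U) :
  #|F| <= 2 * k * n - k + 1.
Proof.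
case: (posnP k) => [k0|k0].
  (* For [k = 0] a nonempty member would by itself be an antichain that is too large. *)
  have sF : F \subset [set set0].
    apply/subsetP => U UF; rewrite inE; apply/set0Pn => -[x xU].
    have : #|[set U]| <= k.
      apply: (hwide x); first by rewrite sub1set inE UF.
      by move=> A B; rewrite !inE => /eqP-> /eqP->.
    by rewrite cards1 k0.
  by have := subset_leq_card sF; rewrite cards1; lia.
pose G : rel nat := fun s t => (s < t < s + n) && (window n s t \in F).
pose L0 := [seq (s, s + m) | s <- iota 0 n, m <- iota 1 n.-1].
pose L := [seq x <- L0 | window n x.1 x.2 \in F].
have uL : uniq L.
  rewrite filter_uniq // allpairs_uniq ?iota_uniq // => -[s m] [s' m'] _ _ /= [-> /addnI ->] //.
have cF : #|F| <= size L + 2.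
  have sF : F \subset (F :\: [set set0; setT]) :|: [set set0; setT].
    by apply/subsetP => U UF; rewrite !inE UF andbT orNb.
  apply: leq_trans (subset_leq_card sF) _; apply: leq_trans (leq_card_setU _ _) _.
  apply: leq_add; last by rewrite cards2; case: eqP.
  rewrite cardE -(size_map (fun x => window n x.1 x.2)); apply: uniq_leq_size.
    exact: enum_uniq.
  move=> U; rewrite mem_enum !inE negb_or => /andP[/andP[U0 UT] UF].
  have [i [m [mn eU]]] := harc U UF.
  have m0 : 0 < m.
    rewrite lt0n; apply: contra U0 => /eqP m0; rewrite eU m0; apply/eqP/setP => x.
    by rewrite !inE; apply/existsP => -[[]].
  have mn' : m < n.
    rewrite ltn_neqAle mn andbT; apply: contra UT => /eqP mn'; rewrite eU window_arc mn'.
    apply/eqP/setP => x; rewrite in_setT; apply/windowP.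
    case: (leqP i x) => ix; first by exists x; [have := ltn_ord x; lia | rewrite modn_small].
    by exists (x + n); [have := ltn_ord x; have := ltn_ord i; lia | rewrite modnDr modn_small].
  apply/mapP; exists (val i, val i + m); last by rewrite eU window_arc.
  rewrite mem_filter -window_arc -eU UF; apply/allpairsPdep; exists (val i), m.
  by rewrite !mem_iota; have := ltn_ord i; split=> //; lia.
(* Saturation needs [k <= n]; for larger [k], counting all proper nonempty arcs is enough. *)
case: (leqP k n) => kn; last first.
  have : size L <= size L0 by rewrite size_filter count_size.
  by rewrite size_allpairs !size_iota; nia.
suff : size L + k < 2 * k * n by lia.
apply: (periodic_bound n k G) => //; first by rewrite k0.
- by move=> s t; rewrite /G window_periodic !ltn_add2r.
- by move=> s t /andP[].
- move=> s t [Gst cr].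
  pose U (i : 'I_k.+1) := window n (s i) (t i).
  have Ub (i : 'I_k.+1) : s i < t i < s i + n by have /andP[] := Gst i (ltn_ord i).
  have nsub (i j : 'I_k.+1) : U i \subset U j -> i = j.
    move=> sub; apply/val_inj; case: (ltngtP i j) => // ij.
      have [h1 h2 h3] := cr i j ij (ltn_ord j).
      have [] := window_nsub n (s i) (t i) (s j) (t j); try by have := Ub i; have := Ub j; lia.
      by rewrite -/(U i) -/(U j) sub.
    have [h1 h2 h3] := cr j i ij (ltn_ord i).
    have [] := window_nsub n (s j) (t j) (s i) (t i); try by have := Ub i; have := Ub j; lia.
    by rewrite -/(U i) -/(U j) sub.
  have : #|[set U i | i : 'I_k.+1]| <= k.
    (* The last left end [s k] lies in every interval of the crossing, so its residue is common to
       all [k + 1] windows. *)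
    apply: (hwide (Ordinal (ltn_pmod (s k) hn))).
      apply/subsetP => _ /imsetP[i _ ->]; rewrite inE.
      have /andP[_ ->] := Gst i (ltn_ord i); apply/windowP; exists (s k) => //.
      case: (ltngtP i k) => ik; last by have := Ub i; rewrite ik; lia.
        by have [? ? _] := cr i k ik (ltnSn k); lia.
      by have := ltn_ord i; lia.
    by move=> _ _ /imsetP[i _ ->] /imsetP[j _ ->] /nsub ->.
  by rewrite card_imset ?card_ord ?ltnn // => i j e; apply: nsub; rewrite e.
move=> x; rewrite mem_filter => /andP[xF /allpairsPdep[i [m [ii mm e]]]].
move: ii mm xF; rewrite e !mem_iota /= => ii mm xF.
by rewrite /G xF; lia.
Qed.
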